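(* Let $\mathcal{X},\mathcal{Y}$ be finite alphabets and $P_{XY}$ a joint PMF on $\mathcal{X}\times\mathcal{Y}$ with $P_X$ fully supported on $\mathcal{X}$. Let $(X^N,Y^N)\sim P_{XY}^{\otimes N}$, let $M\in\mathbb{N}$, $\beta>0$, $L=\beta\log M$ and $N=ML$ (integer constraints ignored). Split $X^N$ into the $M$ consecutive non-overlapping fragments $\boldsymbol{X}(i)=X_{(i-1)L+1}^{iL}$, $i\in[M]$. Let $\hat{X}^N$ be a maximum-likelihood reconstruction, i.e. $\hat X^N\in\arg\max_{\tilde X^N\in\mathcal{A}_L(X^N)}\mathbb{P}[Y^N\mid \tilde X^N]$, where $\mathcal{A}_L(X^N)=\{(\boldsymbol{X}(\pi(1)),\ldots,\boldsymbol{X}(\pi(M))):\pi\in S_M\}$, with fragments $\hat{\boldsymbol{X}}(i)=\hat X_{(i-1)L+1}^{iL}$. Let $\Xi=\frac1M\sum_{i\in[M]}\mathbb{1}\{\hat{\boldsymbol{X}}(i)\neq\boldsymbol{X}(i)\}$ and $\mathsf{FP}(\xi)=\mathbb{P}[\Xi\geq\xi,\ \hat X^N\neq X^N]$ for $\xi\in[0,1)$. Define $$\psi_2(P_{XY})=\min_{Q_{X_1X_2}\in\mathcal{P}(\mathcal{X}^2)}\Big\{\tfrac12 D_{\mathrm{KL}}(Q_{X_1X_2}\,\|\,P_X^{\otimes 2})+d_{P_{Y|X}}(Q_{X_1X_2})\Big\}.$$ If $\beta>1/\psi_2(P_{XY})$, then as $M\to\infty$: (i) $\mathsf{FP}(0)=O\big(M^{2[1-\beta\psi_2(P_{XY})]}\big)$,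 with a constant depending on $P_{XY}$; (ii) for every $\xi\in(0,1)$, $\mathsf{FP}(\xi)\leq\exp\!\Big[-M\log M\cdot\xi\big(\beta\psi_2(P_{XY})-1-O(1/M)\big)\Big]$.
   Context: For $x_1,x_2\in\mathcal{X}$ the Bhattacharyya distance is $d_{P_{Y|X}}(x_1,x_2)=-\log\sum_{y\in\mathcal{Y}}\sqrt{P_{Y|X}(y|x_1)P_{Y|X}(y|x_2)}$, and for a joint PMF $Q_{X_1X_2}$ on $\mathcal{X}^2$, $d_{P_{Y|X}}(Q_{X_1X_2})=\sum_{x_1,x_2}Q_{X_1X_2}(x_1,x_2)\,d_{P_{Y|X}}(x_1,x_2)$. $\mathcal{P}(\mathcal{X}^2)$ is the probability simplex on $\mathcal{X}^2$, $S_M$ the symmetric group on $[M]=\{1,\dots,M\}$, and logarithms are natural. *)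

(* Defs.v *)
From HB Require Import structures.
From mathcomp Require Import all_boot all_order all_algebra all_fingroup.
From mathcomp Require Import classical_sets reals sequences exp.
Set Implicit Arguments. Unset Strict Implicit. Unset Printing Implicit Defensive.
Import Order.TTheory GRing.Theory Num.Theory.
Local Open Scope ring_scope.

Section Defs.
Variables (R : realType) (X Y : finType).

Definition is_pmf (T : finType) (Q : T -> R) : Prop :=
  (forall t, 0 <= Q t) /\ \sum_t Q t = 1.

Variable P : X * Y -> R.

Definition PX (x : X) : R := \sum_y P (x, y).
Definition PYgX (y : Y) (x : X) : R := P (x, y) / PX x.

Definition bhat_coef (x1 x2 : X) : R :=
  \sum_y Num.sqrt (PYgX y x1 * PYgX y x2).
Definition bhat_dist (x1 x2 : X) : R := - ln (bhat_coef x1 x2).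
Definition bhat_distQ (Q : X * X -> R) : R :=
  \sum_p Q p * bhat_dist p.1 p.2.

Definition KL2 (Q : X * X -> R) : R :=
  \sum_p (if Q p == 0 then 0 else Q p * ln (Q p / (PX p.1 * PX p.2))).

(* psi_2(P_XY): minimum over the simplex; Q charging a pair with zero
   Bhattacharyya coefficient has objective +oo and is excluded. *)
Definition psi2 : R :=
  inf [set v : R | exists Q : X * X -> R,
         [/\ is_pmf Q, (forall p, Q p != 0 -> bhat_coef p.1 p.2 != 0)
           & v = KL2 Q / 2 + bhat_distQ Q]].

Definition Lfrag (beta : R) (M : nat) : nat := `|Num.ceil (beta * ln M%:R)|%N.

Section Sample.
Variables (M L : nat).
(* the sample (X^N, Y^N), N = M L, position (i-1)L + j  <->  (i, j) *)
Definition Omega := {ffun 'I_M * 'I_L -> X * Y}.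

Definition prob (w : Omega) : R := \prod_k P (w k).

Definition lik (xt : 'I_M * 'I_L -> X) (w : Omega) : R :=
  \prod_k PYgX (w k).2 (xt k).

Definition permute (pi : 'S_M) (w : Omega) : 'I_M * 'I_L -> X :=
  fun k => (w (pi k.1, k.2)).1.

Definition ML (dec : Omega -> 'S_M) : Prop :=
  forall w (pi : 'S_M), lik (permute pi w) w <= lik (permute (dec w) w) w.

Definition frag_err (dec : Omega -> 'S_M) (w : Omega) (i : 'I_M) : bool :=
  [exists j : 'I_L, permute (dec w) w (i, j) != (w (i, j)).1].

Definition Xi (dec : Omega -> 'S_M) (w : Omega) : R :=
  #|[set i | frag_err dec w i]|%:R / M%:R.

Definition seq_err (dec : Omega -> 'S_M) (w : Omega) : bool :=
  [exists k, permute (dec w) w k != (w k).1].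

Definition FP (dec : Omega -> 'S_M) (xi : R) : R :=
  \sum_(w | (xi <= Xi dec w) && seq_err dec w) prob w.
End Sample.
End Defs.

(* Main.v *)
Require Import Defs.
From HB Require Import structures.
From mathcomp Require Import all_boot all_order all_algebra all_fingroup.
From mathcomp Require Import classical_sets reals sequences exp.
From mathcomp Require Import ring lra.
Set Implicit Arguments. Unset Strict Implicit. Unset Printing Implicit Defensive.
Import Order.TTheory GRing.Theory Num.Theory.
Local Open Scope ring_scope.

(** By the union bound over permutations, it suffices to bound, for a permutation
    s of the fragments with k moved points, the probability that s is at least as
    likely as the identity. The Bhattacharyya bound turns it into the mean of
    [\prod_e B(x_e, x_(s e))] over an i.i.d. [x] indexed by the k L moved
    positions, where B is the Bhattacharyya coefficient. Each variable occurs in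
    exactly two factors, so eliminating the variables one at a time by
    Cauchy-Schwarz gives at most [rho ^ (k L)] with
    [rho ^ 2 = \sum P_X(a) P_X(b) B(a, b) ^ 2], and the Gibbs variational
    principle gives [rho <= exp(- psi_2)]. At most [M ^ k] permutations move k
    points, so the union bound is a geometric series of ratio
    [M ^ (1 - beta psi_2)], starting at k = 2, resp. k = xi M. *)

Definition moved (T : finType) (s : {perm T}) : {set T} := [set e | s e != e].

(** * Cauchy-Schwarz for weighted finite sums *)

Section WeightedCauchySchwarz.
Variables (R : realType) (T : finType) (mu : T -> R).
Hypothesis mu_ge0 : forall a, 0 <= mu a.

Lemma weighted_Cauchy_Schwarz (f g : T -> R) :
  \sum_a mu a * (f a * g a) <=
  Num.sqrt (\sum_a mu a * f a ^+ 2) * Num.sqrt (\sum_a mu a * g a ^+ 2).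
Proof.
set A := \sum_a mu a * f a ^+ 2; set B := \sum_a mu a * g a ^+ 2.
set C := \sum_a mu a * (f a * g a).
have A0 : 0 <= A by apply: sumr_ge0 => a _; rewrite mulr_ge0 ?sqr_ge0.
have Lagrange : \sum_a \sum_b mu a * mu b * (f a * g b - f b * g a) ^+ 2 =
    2 * (A * B - C ^+ 2).
  have -> : 2 * (A * B - C ^+ 2) = A * B + B * A - 2 * (C * C) by ring.
  rewrite /A /B /C !big_distrlr /= mulr_sumr -big_split -sumrB /=.
  apply: eq_bigr => a _; rewrite mulr_sumr -big_split -sumrB /=.
  by apply: eq_bigr => b _; ring.
have CAB : C ^+ 2 <= A * B.
  have : 0 <= 2 * (A * B - C ^+ 2).
    rewrite -Lagrange; apply: sumr_ge0 => a _; apply: sumr_ge0 => b _.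
    by rewrite mulr_ge0 ?sqr_ge0 // mulr_ge0.
  by rewrite pmulr_rge0 // subr_ge0.
rewrite -sqrtrM //; apply: le_trans (ler_norm C) _.
by rewrite -sqrtr_sqr ler_wsqrtr.
Qed.

End WeightedCauchySchwarz.

(** * Mean of a product of kernels along the cycles of a permutation *)

Section VertexElimination.
Variables (R : realType) (T : finType) (mu : T -> R) (K : T -> T -> R).
Hypotheses (mu_ge0 : forall a, 0 <= mu a) (mu_sum1 : \sum_a mu a = 1).
Hypothesis K_ge0 : forall a b, 0 <= K a b.

(* [None] marks an argument over which the L2(mu)-norm has been taken. *)
Definition partial_norm (u v : option T) : R :=
  match u, v with
  | Some a, Some b => K a b
  | Some a, None => Num.sqrt (\sum_b mu b * K a b ^+ 2)
  | None, Some b => Num.sqrt (\sum_a mu a * K a b ^+ 2)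
  | None, None => Num.sqrt (\sum_a \sum_b mu a * mu b * K a b ^+ 2)
  end.

Lemma partial_norm_ge0 u v : 0 <= partial_norm u v.
Proof. by case: u v => [a|] [b|] //=; exact: sqrtr_ge0. Qed.

Lemma partial_normr u :
  partial_norm u None = Num.sqrt (\sum_b mu b * partial_norm u (Some b) ^+ 2).
Proof.
case: u => [a|] //=; congr Num.sqrt; rewrite exchange_big /=.
apply: eq_bigr => b _; rewrite sqr_sqrtr; last first.
  by apply: sumr_ge0 => a _; rewrite mulr_ge0 ?sqr_ge0.
by rewrite mulr_sumr; apply: eq_bigr => a _; ring.
Qed.

Lemma partial_norml v :
  partial_norm None v = Num.sqrt (\sum_a mu a * partial_norm (Some a) v ^+ 2).
Proof.
case: v => [b|] //=; congr Num.sqrt.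
apply: eq_bigr => a _; rewrite sqr_sqrtr; last first.
  by apply: sumr_ge0 => b _; rewrite mulr_ge0 ?sqr_ge0.
by rewrite mulr_sumr; apply: eq_bigr => b _; ring.
Qed.

(** Averaging out a variable shared by two factors is one Cauchy-Schwarz; options let the outer
    arguments be already averaged out. *)
Lemma partial_norm_compose u v :
  \sum_a mu a * (partial_norm u (Some a) * partial_norm (Some a) v) <=
  partial_norm u None * partial_norm None v.
Proof. by rewrite partial_normr partial_norml; apply: weighted_Cauchy_Schwarz. Qed.

Variables (V : finType) (s : {perm V}).

Definition upd (A : Type) (x : V -> A) (i : V) (a : A) : V -> A :=
  fun v => if v == i then a else x v.

Definition moved_prod (u : V -> option T) : R :=
  \prod_(e | s e != e) partial_norm (u e) (u (s e)).

(** The variable at [i] enters only the factors at [i] and at its preimage [j]. A 2-cycle, where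
    [s i = j], needs no separate case: the outer arguments of [partial_norm_compose] are
    arbitrary. *)
Lemma moved_prod_eliminate (u : V -> option T) (i : V) :
  s i != i -> u i = None ->
  \sum_a mu a * moved_prod (upd u i (Some a)) <= moved_prod u.
Proof.
move=> si ui; pose j := (s^-1)%g i.
have sj : s j = i by rewrite /j permKV.
have ji : j != i by apply: contraNneq si => jE; rewrite -{1}jE sj.
have sjj : s j != j by rewrite sj eq_sym.
have split_ij (w : V -> option T) : moved_prod w =
    partial_norm (w j) (w i) * partial_norm (w i) (w (s i)) *
    \prod_(e | (s e != e) && (e != i) && (e != j)) partial_norm (w e) (w (s e)).
  rewrite /moved_prod (bigD1 i) //= (bigD1 j) /=; last by rewrite sjj.
  by rewrite sj; ring.
rewrite (split_ij u) ui.
set rest := \prod_(_ | _) _.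
have rest_ge0 : 0 <= rest by apply: prodr_ge0 => e _; exact: partial_norm_ge0.
rewrite (eq_bigr (fun a => mu a * (partial_norm (u j) (Some a) *
    partial_norm (Some a) (u (s i))) * rest)); last first.
  move=> a _; rewrite split_ij /upd eqxx (negbTE ji) (negbTE si) -[RHS]mulrA.
  congr (_ * (_ * _)); apply: eq_bigr => e /andP[/andP[_ ei] ej].
  rewrite (negbTE ei) ifN //; apply: contraNneq ej => sei.
  by rewrite /j -sei permK.
by rewrite -mulr_suml ler_wpM2r // partial_norm_compose.
Qed.

Definition pweight (x : {ffun V -> T}) : R := \prod_v mu (x v).

Lemma pweight_ge0 x : 0 <= pweight x.
Proof. by apply: prodr_ge0. Qed.

Lemma pweight_sum1 : \sum_x pweight x = 1.
Proof.
rewrite -(bigA_distr_bigA (fun _ => mu)) big1 // => v _; exact: mu_sum1.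
Qed.

(* The swap (x, a) |-> (x[i := a], x i) is an involution preserving
   the product weight. *)
Lemma pweight_resample (i : V) (G : {ffun V -> T} -> R) :
  \sum_x pweight x * G x =
  \sum_x pweight x * \sum_a mu a * G (finfun (upd x i a)).
Proof.
pose swap (p : {ffun V -> T} * T) := (finfun (upd p.1 i p.2), p.1 i).
have swapK : involutive swap.
  move=> [x a]; rewrite /swap /=; congr pair; last by rewrite ffunE /upd eqxx.
  apply/ffunP => v; rewrite !ffunE /upd; case: eqVneq => [->|/negbTE vi] //.
  by rewrite ffunE vi.
have -> : \sum_x pweight x * G x = \sum_p pweight p.1 * mu p.2 * G p.1.
  rewrite -(pair_bigA _ (fun x a => pweight x * mu a * G x)) /=.
  apply: eq_bigr => x _; rewrite -[pweight x in LHS]mulr1 -mu_sum1 mulr_sumr.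
  by rewrite mulr_suml.
rewrite (reindex_inj (inv_inj swapK)) /=.
rewrite [RHS](eq_bigr (fun x => \sum_a pweight x * mu a *
    G (finfun (upd x i a)))); last first.
  by move=> x _; rewrite mulr_sumr; apply: eq_bigr => a _; rewrite mulrA.
rewrite pair_bigA /=; apply: eq_bigr => -[x a] _ /=; congr (_ * _).
rewrite /pweight (bigD1 i) // [in RHS](bigD1 i) //= ffunE /upd eqxx.
rewrite mulrAC [RHS]mulrAC [mu a * _]mulrC; congr (_ * _).
by apply: eq_bigr => v vi; rewrite ffunE (negbTE vi).
Qed.

Definition masked (A : {set V}) (x : V -> T) : V -> option T :=
  fun v => if v \in A then None else Some (x v).

Definition masked_mean (A : {set V}) : R :=
  \sum_(x : {ffun V -> T}) pweight x * moved_prod (masked A x).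

(** Resampling coordinate [i] isolates its average, which the elimination bound trades for a mask at
    [i]. *)
Lemma masked_mean_add (A : {set V}) (i : V) :
  s i != i -> i \notin A -> masked_mean A <= masked_mean (i |: A).
Proof.
move=> si iA; rewrite /masked_mean (pweight_resample i).
apply: ler_sum => x _; apply: ler_wpM2l; first exact: pweight_ge0.
have maskNi : masked (i |: A) x i = None by rewrite /masked setU11.
apply: le_trans (moved_prod_eliminate si maskNi).
rewrite le_eqVlt; apply/orP; left; apply/eqP; apply: eq_bigr => a _.
have maskE v : masked A (finfun (upd x i a)) v =
    upd (masked (i |: A) x) i (Some a) v.
  rewrite /masked /upd ffunE in_setU1; case: (v =P i) => [->|//].
  by rewrite (negbTE iA).
by congr (_ * _); apply: eq_bigr => e _; rewrite !maskE.
Qed.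

Lemma mean_perm_kernel_le :
  \sum_(x : {ffun V -> T}) pweight x * \prod_(e | s e != e) K (x e) (x (s e)) <=
  Num.sqrt (\sum_a \sum_b mu a * mu b * K a b ^+ 2) ^+ #|moved s|.
Proof.
have le_mean (A : {set V}) : A \subset moved s ->
    masked_mean finset.set0 <= masked_mean A.
  move: {2}#|A| (erefl #|A|) => n; elim: n A => [|n IH] A cA sA.
    by move/eqP: cA; rewrite cards_eq0 => /eqP ->.
  have [i iA] : {i | i \in A} by apply/sigW/finset.set0Pn; rewrite -card_gt0 cA.
  have si : s i != i by have := fintype.subsetP sA _ iA; rewrite inE.
  rewrite -(finset.setD1K iA); apply: le_trans (masked_mean_add si _); last first.
    by rewrite !inE eqxx.
  apply: IH; first by move: cA; rewrite (cardsD1 i) iA => -[].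
  exact: fintype.subset_trans (finset.subD1set _ _) sA.
have -> : \sum_x pweight x * \prod_(e | s e != e) K (x e) (x (s e)) =
    masked_mean finset.set0.
  apply: eq_bigr => x _; congr (_ * _); apply: eq_bigr => e _.
  by rewrite /masked /moved !inE.
apply: le_trans (le_mean _ (subxx _)) _; rewrite /masked_mean.
(* [s] preserves its moved set, so once all of it is masked every factor is the same constant. *)
rewrite (eq_bigr (fun x => pweight x * Num.sqrt (\sum_a \sum_b mu a * mu b *
    K a b ^+ 2) ^+ #|moved s|)); last first.
  move=> x _; congr (_ * _); rewrite /moved_prod.
  rewrite -prodr_const [RHS](eq_bigl (fun e => s e != e)) => [|e]; last first.
    by rewrite inE.
  apply: eq_bigr => e se; rewrite /masked /moved !inE se.
  by rewrite (inj_eq perm_inj) se.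
by rewrite -mulr_suml pweight_sum1 mul1r.
Qed.

End VertexElimination.

(** * Counting permutations by their number of moved points *)

Lemma ffact_le_expn n k : (n ^_ k <= n ^ k)%N.
Proof.
elim: k => [|k IH]; first by rewrite ffactn0.
by rewrite ffactnSr expnSr leq_mul // leq_subr.
Qed.

(** Choose the moved set, then one of the [k] factorial permutations supported on it: the two counts
    multiply to a falling factorial. *)
Lemma card_perm_moved (T : finType) (k : nat) :
  (#|[set s : {perm T} | #|moved s| == k]| <= #|T| ^ k)%N.
Proof.
rewrite -sum1_card.
rewrite (partition_big (@moved T) (fun A => A \in [set A : {set T} | #|A| == k]));
  last by move=> s; rewrite !inE.
apply: leq_trans (ffact_le_expn _ _); rewrite -bin_ffact -card_draws.
rewrite -sum_nat_const; apply: leq_sum => A; rewrite inE => /eqP cA.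
rewrite sum1_card -cA -card_perm; apply: subset_leq_card.
apply/fintype.subsetP => s /andP[_ /eqP <-]; rewrite unfold_in.
by apply/fintype.subsetP => e; rewrite unfold_in inE.
Qed.

(** The image of a moved point is moved too. This is the source of the 2 in the exponent of claim
    (i). *)
Lemma card_moved_gt1 (T : finType) (s : {perm T}) (i : T) :
  s i != i -> (1 < #|moved s|)%N.
Proof.
move=> si; have <- : #|[set i; s i]| = 2%N by rewrite cards2 eq_sym si.
apply: subset_leq_card; apply/fintype.subsetP => e; rewrite !inE.
by case/orP => /eqP -> //; rewrite (inj_eq perm_inj).
Qed.

(** * Sums over permutations and geometric tails *)

Section Sums.
Variable R : realType.

Lemma sum_perm_moved (T : finType) (t q : R) : 0 <= q ->
  \sum_(s : {perm T} | t <= #|moved s|%:R) q ^+ #|moved s| <=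
  \sum_(k < #|T|.+1 | t <= k%:R) (#|T|%:R * q) ^+ k.
Proof.
move=> q0; pose h (s : {perm T}) : 'I_(#|T|.+1) := inord #|moved s|.
have hE s : h s = #|moved s| :> nat by rewrite inordK // ltnS max_card.
rewrite (partition_big h (fun k : 'I__ => t <= k%:R)) /=; last first.
  by move=> s; rewrite hE.
apply: ler_sum => k _; rewrite exprMn.
apply: (@le_trans _ _ (\sum_(s in [set s : {perm T} | #|moved s| == k]) q ^+ k)).
  rewrite (eq_bigr (fun=> q ^+ k)); last first.
    by move=> s /andP[_ /eqP <-]; rewrite hE.
  rewrite big_mkcond [leRHS]big_mkcond; apply: ler_sum => s _.
  rewrite inE -hE -val_eqE; case: (t <= _) => /=; first exact: lexx.
  by case: ifP => _; rewrite ?exprn_ge0.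
rewrite sumr_const -[leLHS]mulr_natl ler_wpM2r ?exprn_ge0 //.
by rewrite -natrX ler_nat card_perm_moved.
Qed.

(** Rounding [t] up to [m] only lowers the power since [r < 1]; the factor 2 bounds
    [1 / (1 - r)]. *)
Lemma geometric_tail_le (n : nat) (r t : R) : 0 < r -> r <= 2^-1 -> 0 <= t ->
  \sum_(k < n | t <= k%:R) r ^+ k <= 2 * r `^ t.
Proof.
move=> r0 r2 t0; pose m := `|Num.ceil t|%N.
have ct0 : 0 <= Num.ceil t by rewrite ceil_ge0; lra.
have tm : t <= m%:R by rewrite /m natr_absz ger0_norm // ceil_ge.
have tk (k : nat) : t <= k%:R -> (m <= k)%N.
  move=> tk; rewrite -(ler_nat int) !natz /m.
  by rewrite gez0_abs // ceil_le_int -pmulrn.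
apply: (@le_trans _ _ (2 * r ^+ m)); last first.
  rewrite ler_wpM2l // -(powR_mulrn _ (ltW r0)) /powR (gt_eqF r0) ler_expR.
  by rewrite ler_wnM2r // ln_le0 //; lra.
apply: (@le_trans _ _ (\sum_(m <= k < m + n) r ^+ k)).
  rewrite big_geq_mkord addnC big_split_ord /=.
  rewrite -[leLHS]addr0 lerD //; last first.
    by apply: sumr_ge0 => i _; rewrite exprn_ge0 // ltW.
  rewrite big_mkcond [leRHS]big_mkcond; apply: ler_sum => k _.
  case: ifP => [/tk -> //|_]; case: ifP => // _.
  by rewrite exprn_ge0 // ltW.
rewrite geometric_partial_tail.
apply: le_trans (geometric_le_lim _ _ _ _) _ => //.
- by rewrite exprn_ge0 // ltW.
- by rewrite ger0_norm ?(ltW r0) //; lra.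
rewrite mulrC ler_wpM2r ?exprn_ge0 ?(ltW r0) //.
by rewrite -[leRHS]invrK lef_pV2 ?posrE; lra.
Qed.

Lemma sqrtr_prod (I : finType) (F : I -> R) : (forall i, 0 <= F i) ->
  Num.sqrt (\prod_i F i) = \prod_i Num.sqrt (F i).
Proof.
move=> F0; elim/big_rec2: _ => [|i a b _ <-]; first exact: sqrtr1.
by rewrite sqrtrM.
Qed.

End Sums.

(** * Bhattacharyya coefficients and the Gibbs variational principle *)

Section Channel.
Variables (R : realType) (X Y : finType) (P : X * Y -> R).
Hypotheses (P_pmf : is_pmf P) (PX_gt0 : forall x, 0 < PX P x).

Let PX_ge0 x : 0 <= PX P x. Proof. exact: ltW. Qed.

Lemma PYgX_ge0 y x : 0 <= PYgX P y x.
Proof. by rewrite divr_ge0 //; case: P_pmf. Qed.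

Lemma PYgX_sum1 x : \sum_y PYgX P y x = 1.
Proof. by rewrite /PYgX -mulr_suml -/(PX P x) divff // gt_eqF. Qed.

Lemma PX_sum1 : \sum_x PX P x = 1.
Proof.
case: P_pmf => _ <-; rewrite pair_bigA /=.
by apply: eq_bigr => -[].
Qed.

Lemma bhat_coef_ge0 x1 x2 : 0 <= bhat_coef P x1 x2.
Proof. by apply: sumr_ge0 => y _; exact: sqrtr_ge0. Qed.

Lemma bhat_coef_diag x : bhat_coef P x x = 1.
Proof.
rewrite -(PYgX_sum1 x); apply: eq_bigr => y _.
by rewrite -expr2 sqrtr_sqr ger0_norm // PYgX_ge0.
Qed.

Lemma bhat_coef_le1 x1 x2 : bhat_coef P x1 x2 <= 1.
Proof.
have CS := @weighted_Cauchy_Schwarz R Y (fun=> 1) (fun=> ler01)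
  (fun y => Num.sqrt (PYgX P y x1)) (fun y => Num.sqrt (PYgX P y x2)).
have S1 x : \sum_y 1 * Num.sqrt (PYgX P y x) ^+ 2 = 1.
  rewrite -[RHS](PYgX_sum1 x); apply: eq_bigr => y _.
  by rewrite mul1r sqr_sqrtr ?PYgX_ge0.
move: CS; rewrite !S1 sqrtr1 mul1r; apply: le_trans.
by apply: ler_sum => y _; rewrite mul1r sqrtrM ?PYgX_ge0.
Qed.

(** This is [rho ^ 2], the squared L2 norm of the Bhattacharyya kernel under two independent
    letters. *)
Definition collision : R :=
  \sum_x1 \sum_x2 PX P x1 * PX P x2 * bhat_coef P x1 x2 ^+ 2.

Let weight (p : X * X) : R := PX P p.1 * PX P p.2.

Let weight_gt0 p : 0 < weight p. Proof. by rewrite mulr_gt0. Qed.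

Let weight_sum1 : \sum_p weight p = 1.
Proof.
rewrite -(pair_bigA _ (fun x1 x2 => PX P x1 * PX P x2)) /=.
rewrite (eq_bigr (fun x1 => PX P x1)) ?PX_sum1 // => x1 _.
by rewrite -mulr_sumr PX_sum1 mulr1.
Qed.

Lemma collisionE : collision = \sum_p weight p * bhat_coef P p.1 p.2 ^+ 2.
Proof. by rewrite /collision pair_bigA. Qed.

Lemma collision_gt0 : 0 < collision.
Proof.
(* An empty alphabet contradicts total mass one; otherwise a diagonal pair contributes a positive
   term. *)
case: (pickP (predT : pred X)) => [x _|X0]; last first.
  by move: PX_sum1; rewrite big_pred0 // => /eqP; rewrite eq_sym oner_eq0.
have term_ge0 p : 0 <= weight p * bhat_coef P p.1 p.2 ^+ 2.
  by rewrite mulr_ge0 ?sqr_ge0 // ltW.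
rewrite collisionE (bigD1 (x, x)) //= ltr_pwDl //; last exact: sumr_ge0.
by rewrite bhat_coef_diag expr1n mulr1.
Qed.

(** Gibbs' inequality term by term: [ln (1 + x) <= x] gives [Q ln (Q / w) >= Q - w], and both laws
    have mass one. *)
Lemma KL2_ge0 (Q : X * X -> R) : is_pmf Q -> 0 <= KL2 P Q.
Proof.
case=> Q0 Q1; have <- : \sum_p (Q p - weight p) = 0.
  by rewrite sumrB Q1 weight_sum1 subrr.
apply: ler_sum => p _; case: eqVneq => [->|Qp].
  by rewrite sub0r oppr_le0 ltW.
have Qgt0 : 0 < Q p by rewrite lt_def Qp Q0.
rewrite -[weight p](@mulfK _ (Q p)) // [weight p * _]mulrC -mulrA.
rewrite -{1}[Q p]mulr1 -mulrBr ler_wpM2l //.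
rewrite ln_div ?posrE //; last exact: weight_gt0.
have := @le_ln1Dx R (weight p / Q p - 1).
rewrite addrCA subrr addr0 ln_div ?posrE //.
have : 0 < weight p / Q p by rewrite divr_gt0.
rewrite -/(weight p) => w0 H; have := H _.
lra.
Qed.

Lemma bhat_distQ_ge0 (Q : X * X -> R) : is_pmf Q -> 0 <= bhat_distQ P Q.
Proof.
case=> Q0 _; apply: sumr_ge0 => p _; rewrite mulr_ge0 // oppr_ge0 ln_le0 //.
exact: bhat_coef_le1.
Qed.

(* The tilted law Q = weight * bhat_coef^2 / collision attains the minimum. *)
Lemma psi2_le : psi2 P <= - ln collision / 2.
Proof.
pose Q p := weight p * bhat_coef P p.1 p.2 ^+ 2 / collision.
have Z0 := collision_gt0.
have Q0 p : 0 <= Q p.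
  by rewrite divr_ge0 ?(ltW Z0) // mulr_ge0 ?sqr_ge0 // ltW.
have Q1 : \sum_p Q p = 1 by rewrite -mulr_suml -collisionE divff // gt_eqF.
have QB p : Q p != 0 -> bhat_coef P p.1 p.2 != 0.
  by apply: contraNneq => B0; rewrite /Q B0 expr0n mulr0 mul0r.
(* The infimum lies below its members once the set is bounded below; both terms of the objective are
   nonnegative, so 0 is a bound. *)
apply: ge_inf.
  exists 0 => _ [Q' [Q'pmf _ ->]].
  by rewrite addr_ge0 ?divr_ge0 ?KL2_ge0 ?bhat_distQ_ge0.
exists Q; split => //.
rewrite /KL2 /bhat_distQ mulr_suml -big_split /=.
(* Under the tilted law the [ln] of the coefficient cancels between the two terms, leaving the same
   constant at every pair. *)
have -> : - ln collision / 2 = \sum_p Q p * (- ln collision / 2).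
  by rewrite -mulr_suml Q1 mul1r.
apply: eq_bigr => p _.
case: eqVneq => [->|Qp]; first by rewrite !mul0r add0r.
have B0 : 0 < bhat_coef P p.1 p.2 by rewrite lt_def QB // bhat_coef_ge0.
have -> : Q p / (PX P p.1 * PX P p.2) = bhat_coef P p.1 p.2 ^+ 2 / collision.
  rewrite /Q /weight; field.
  by rewrite gt_eqF //= !gt_eqF.
rewrite ln_div ?posrE ?exprn_gt0 // lnXn // /bhat_dist.
by field.
Qed.

Lemma sqrt_collision_le : Num.sqrt collision <= expR (- psi2 P).
Proof.
rewrite -[leRHS]ger0_norm ?expR_ge0 // -sqrtr_sqr ler_wsqrtr //.
rewrite -expRM_natl -[leLHS]lnK ?posrE ?collision_gt0 // ler_expR.
have := psi2_le; lra.
Qed.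

(** * Maximum-likelihood decoding and the union bound *)

Section Decoding.
Variables (M L : nat).

(** Acting on positions rather than fragments puts the elimination bound at the level of i.i.d.
    letters. *)
Definition frag_perm_fun (s : 'S_M) (k : 'I_M * 'I_L) := (s k.1, k.2).

Lemma frag_perm_fun_inj s : injective (frag_perm_fun s).
Proof. by move=> [i j] [i' j'] [/perm_inj -> ->]. Qed.

Definition frag_perm s : {perm 'I_M * 'I_L} := perm (@frag_perm_fun_inj s).

Lemma card_moved_frag_perm s : #|moved (frag_perm s)| = (#|moved s| * L)%N.
Proof.
have -> : moved (frag_perm s) = finset.setX (moved s) [set: 'I_L]%SET.
  apply/setP => -[i j]; rewrite !inE permE /frag_perm_fun xpair_eqE eqxx.
  by rewrite !andbT.
by rewrite cardsX cardsT card_ord.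
Qed.

Lemma sum_Omega (F : {ffun 'I_M * 'I_L -> X} -> {ffun 'I_M * 'I_L -> Y} -> R) :
  \sum_(w : Omega X Y M L) F [ffun k => (w k).1] [ffun k => (w k).2] =
  \sum_x \sum_y F x y.
Proof.
rewrite pair_bigA /=.
rewrite (reindex (fun p : {ffun 'I_M * 'I_L -> X} * {ffun 'I_M * 'I_L -> Y} =>
  [ffun k => (p.1 k, p.2 k)] : Omega X Y M L)) /=; last first.
  exists (fun w => ([ffun k => (w k).1], [ffun k => (w k).2])).
    move=> [x y] _ /=; congr pair; apply/ffunP => k; by rewrite !ffunE.
  by move=> w _; apply/ffunP => k; rewrite !ffunE /=; case: (w k).
apply: eq_bigr => -[x y] _ /=.
by congr F; apply/ffunP => k; rewrite !ffunE.
Qed.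

Lemma prob_ge0 (w : Omega X Y M L) : 0 <= prob P w.
Proof. by apply: prodr_ge0 => k _; case: P_pmf. Qed.

Lemma probE (w : Omega X Y M L) :
  prob P w = \prod_k PX P (w k).1 * \prod_k PYgX P (w k).2 (w k).1.
Proof.
rewrite -big_split; apply: eq_bigr => k _ /=.
by rewrite /PYgX mulrC divfK ?gt_eqF //; case: (w k).
Qed.

(* Bhattacharyya bound: on the event, lik(id) <= sqrt (lik(id) * lik(s)). *)
Lemma pairwise_error_le (s : 'S_M) :
  \sum_(w : Omega X Y M L | lik P (permute 1%g w) w <= lik P (permute s w) w)
     prob P w <=
  Num.sqrt collision ^+ (#|moved s| * L).
Proof.
pose F (x : {ffun 'I_M * 'I_L -> X}) (y : {ffun 'I_M * 'I_L -> Y}) :=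
  \prod_k PX P (x k) *
  \prod_k Num.sqrt (PYgX P (y k) (x k) * PYgX P (y k) (x (frag_perm s k))).
have F0 x y : 0 <= F x y.
  by rewrite mulr_ge0 ?prodr_ge0 // => k _; rewrite ?sqrtr_ge0.
apply: (@le_trans _ _ (\sum_x \sum_y F x y)).
  rewrite -sum_Omega big_mkcond; apply: ler_sum => w _.
  case: ifP => // le_lik; rewrite probE /F.
  have -> : \prod_k PX P ([ffun k => (w k).1] k) = \prod_k PX P (w k).1.
    by apply: eq_bigr => k _; rewrite ffunE.
  rewrite ler_wpM2l ?prodr_ge0 //.
  rewrite -sqrtr_prod; last by move=> k; rewrite mulr_ge0 ?PYgX_ge0.
  rewrite [in leRHS]big_split /=.
  set a := (X in X <= _); set b := (X in Num.sqrt (X * _)).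
  set c := (X in Num.sqrt (_ * X)).
  have a0 : 0 <= a by apply: prodr_ge0 => k _; exact: PYgX_ge0.
  have -> : b = a by apply: eq_bigr => k _; rewrite !ffunE.
  have ac : a <= c.
    move: le_lik; congr (_ <= _); apply: eq_bigr => -[i j] _.
      by rewrite /permute perm1.
    by rewrite !ffunE permE.
  rewrite -[leLHS]ger0_norm // -sqrtr_sqr ler_wsqrtr // expr2.
  by rewrite ler_wpM2l.
rewrite -card_moved_frag_perm.
apply: le_trans (mean_perm_kernel_le PX_ge0 PX_sum1 bhat_coef_ge0 _).
rewrite le_eqVlt; apply/orP; left; apply/eqP; apply: eq_bigr => x _.
rewrite /F -mulr_sumr; congr (_ * _).
(* For fixed letters, the sum over outputs factorises over positions into Bhattacharyya
   coefficients. *)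
rewrite -(bigA_distr_bigA (fun k y =>
  Num.sqrt (PYgX P y (x k) * PYgX P y (x (frag_perm s k))))) /=.
(* A fixed position contributes the diagonal coefficient, which is 1. *)
rewrite [RHS]big_mkcond /=; apply: eq_bigr => k _.
by case: eqVneq => //= ->; rewrite -(bhat_coef_diag (x k)).
Qed.

Lemma FP_le (dec : Omega X Y M L -> 'S_M) (xi t : R) : ML P dec ->
  (forall w, xi <= Xi R dec w -> seq_err dec w -> t <= #|moved (dec w)|%:R) ->
  FP P dec xi <=
  \sum_(s : 'S_M | t <= #|moved s|%:R) (Num.sqrt collision ^+ L) ^+ #|moved s|.
Proof.
move=> ml err_t.
apply: (@le_trans _ _ (\sum_(s : 'S_M | t <= #|moved s|%:R)
    \sum_(w : Omega X Y M L | lik P (permute 1%g w) w <= lik P (permute s w) w)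
     prob P w)); last first.
  by apply: ler_sum => s _; rewrite -exprM mulnC pairwise_error_le.
rewrite /FP (partition_big dec (fun s : 'S_M => t <= #|moved s|%:R)); last first.
  by move=> w /andP[]; exact: err_t.
apply: ler_sum => s _; rewrite big_mkcond [leRHS]big_mkcond.
(* The decoded permutation is at least as likely as the identity, so the outcome lies in its
   pairwise error event. *)
apply: ler_sum => w _; case: ifP => [/andP[_ /eqP <-]|_]; first by rewrite ml.
by case: ifP => _ //; exact: prob_ge0.
Qed.

Lemma seq_err_moved (dec : Omega X Y M L -> 'S_M) w :
  seq_err dec w -> (1 < #|moved (dec w)|)%N.
Proof.
case/existsP => -[i j]; rewrite /permute /= => ne.
by apply: (@card_moved_gt1 _ _ i); apply: contraNneq ne => ->.
Qed.

(** A wrong fragment is a moved one; the converse can fail, as distinct fragments may carry equal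
    letters. *)
Lemma Xi_le_moved (dec : Omega X Y M L -> 'S_M) w (xi : R) : (0 < M)%N ->
  xi <= Xi R dec w -> xi * M%:R <= #|moved (dec w)|%:R.
Proof.
move=> M0; rewrite ler_pdivlMr ?ltr0n // => /le_trans; apply.
rewrite ler_nat; apply: subset_leq_card; apply/fintype.subsetP => i.
rewrite !inE => /existsP[j]; rewrite /permute /=.
by apply: contraNneq => ->.
Qed.

End Decoding.

(** Serves both claims, with different [t]. The hypothesis on [ln 2] makes the ratio [r] at most one
    half. *)
Lemma FP_rate_le (beta : R) (M : nat)
    (dec : Omega X Y M (Lfrag beta M) -> 'S_M) (xi t : R) :
  (1 < M)%N -> 0 < beta -> 1 < beta * psi2 P ->
  ln 2 <= (beta * psi2 P - 1) * ln M%:R -> ML P dec -> 0 <= t ->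
  (forall w, xi <= Xi R dec w -> seq_err dec w -> t <= #|moved (dec w)|%:R) ->
  FP P dec xi <= 2 * expR (t * ((1 - beta * psi2 P) * ln M%:R)).
Proof.
move=> M1 b0 bpsi lnM2 ml t0 err_t; have M0 : 0 < M%:R :> R by rewrite ltr0n ltnW.
set r := expR ((1 - beta * psi2 P) * ln M%:R).
have rE : expR (t * ((1 - beta * psi2 P) * ln M%:R)) = r `^ t.
  by rewrite mulrC expRM.
have r2 : r <= 2^-1.
  rewrite -[2^-1]lnK ?posrE ?invr_gt0 // ler_expR lnV ?posrE //.
  by move: lnM2; lra.
have psi0 : 0 < psi2 P by rewrite -(pmulr_rgt0 _ b0); lra.
(* Each moved fragment costs [M] in the count and gains [rho ^ L]; rounding [L] up is harmless since
   [psi2 P > 0]. *)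
have Mq : M%:R * Num.sqrt collision ^+ Lfrag beta M <= r.
  have le_q : Num.sqrt collision ^+ Lfrag beta M <=
      expR (- (beta * psi2 P) * ln M%:R).
    apply: (@le_trans _ _ (expR (- psi2 P) ^+ Lfrag beta M)).
      by rewrite lerXn2r ?nnegrE ?sqrtr_ge0 ?expR_ge0 ?sqrt_collision_le.
    rewrite -expRM_natl ler_expR.
    have lnM0 : 0 <= ln M%:R :> R by rewrite ln_ge0 // ler1n ltnW.
    have : beta * ln M%:R <= (Lfrag beta M)%:R.
      rewrite /Lfrag natr_absz ger0_norm ?ceil_ge // ceil_ge0.
      by apply: lt_le_trans (_ : 0 <= _); [lra|rewrite mulr_ge0 // ltW].
    move=> /(ler_wpM2l (ltW psi0)); lra.
  rewrite /r mulrBl mul1r expRD lnK ?posrE // ler_wpM2l ?(ltW M0) //.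
  by rewrite -mulNr.
rewrite rE; apply: le_trans (FP_le ml err_t) _.
apply: le_trans (sum_perm_moved _ _ _) _; first by rewrite exprn_ge0 ?sqrtr_ge0.
rewrite card_ord.
apply: le_trans (geometric_tail_le M.+1 (expR_gt0 _) r2 t0).
apply: ler_sum => k _; rewrite lerXn2r ?nnegrE ?expR_ge0 //.
by rewrite mulr_ge0 ?exprn_ge0 ?sqrtr_ge0 ?(ltW M0).
Qed.

End Channel.

(** * Asymptotics in the number of fragments *)

Lemma eventually_ln_ge (R : realType) (c : R) :
  exists M0 : nat, (1 < M0)%N /\ forall M : nat, (M0 <= M)%N -> c <= ln M%:R.
Proof.
exists (maxn 2 (Num.bound (expR c))); split; first exact: leq_maxl.
move=> M; rewrite geq_max => /andP[M2 bM].
rewrite -ler_expR lnK ?posrE ?ltr0n ?(ltnW M2) //.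
apply: ltW; apply: lt_le_trans (archi_boundP (expR_ge0 c)) _.
by rewrite ler_nat.
Qed.

Theorem theorem1 (R : realType) (X Y : finType) (P : X * Y -> R) (beta : R) :
  is_pmf P -> (forall x, 0 < PX P x) -> 0 < beta ->
  1 < beta * psi2 P ->
  (exists C : R, exists M0 : nat, forall M : nat, (M0 <= M)%N ->
     forall dec : Omega X Y M (Lfrag beta M) -> 'S_M, ML P dec ->
       FP P dec 0 <= C * (M%:R `^ (2 * (1 - beta * psi2 P))))
  /\
  (forall xi : R, 0 < xi < 1 ->
     exists C : R, exists M0 : nat, forall M : nat, (M0 <= M)%N ->
     forall dec : Omega X Y M (Lfrag beta M) -> 'S_M, ML P dec ->
       FP P dec xi <=
         expR (- (M%:R * ln M%:R) * (xi * (beta * psi2 P - 1 - C / M%:R)))).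
Proof.
move=> P_pmf PX_gt0 b0 bpsi.
have [M0 [M0_gt1 lnM0]] := eventually_ln_ge (ln 2 / (beta * psi2 P - 1)).
have lnM M : (M0 <= M)%N -> ln 2 <= (beta * psi2 P - 1) * ln M%:R.
  by move=> /lnM0; rewrite ler_pdivrMr ?subr_gt0 // mulrC.
split=> [|xi /andP[xi0 _]].
  (* The constant 2 is that of the geometric tail, and [t = 2] since an error moves at least two
     fragments. *)
  exists 2, M0 => M M0M dec ml; have M1 := leq_trans M0_gt1 M0M.
  have := FP_rate_le (t := 2) P_pmf PX_gt0 M1 b0 bpsi (lnM _ M0M) ml.
  rewrite /powR gt_eqF ?ltr0n ?(ltnW M1) // -mulrA; apply=> // w _ err.
  by rewrite ler_nat seq_err_moved.
(* With [C = 1 / xi] the correction term amounts to a factor [M], which absorbs the 2 of the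
   geometric tail as [M >= 2]. *)
exists xi^-1, M0 => M M0M dec ml; have M1 := leq_trans M0_gt1 M0M.
have M_gt0 : 0 < M%:R :> R by rewrite ltr0n ltnW.
apply: le_trans (FP_rate_le (t := xi * M%:R) P_pmf PX_gt0 M1 b0 bpsi
  (lnM _ M0M) ml _ _) _.
- by rewrite mulr_ge0 // ltW.
- by move=> w le_xi _; apply: Xi_le_moved; first exact: ltnW.
have -> : - (M%:R * ln M%:R) * (xi * (beta * psi2 P - 1 - xi^-1 / M%:R)) =
    ln M%:R + xi * M%:R * ((1 - beta * psi2 P) * ln M%:R).
  by field; rewrite !gt_eqF.
by rewrite expRD lnK ?posrE // ler_wpM2r ?expR_ge0 // ler_nat.
Qed.
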